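(* Let $f:[0,1]\to[0,1]$ be a symmetric unimodal map with $f(\tfrac12)=1$, and let $\psi:[0,1]\to[0,1]$ be the decreasing symmetric Lorenz map obtained from $f$. If $\psi$ has a periodic point of prime period $n$, then for every positive integer $m$ with $m\prec n$ in the Sharkovsky order and $m\notin\{2^r : r\geq 1\}$, $\psi$ has a periodic point of prime period $m$.
   Context: A symmetric unimodal map is a continuous map $f:[0,1]\to[0,1]$ that is strictly increasing on $[0,c]$ and strictly decreasing on $[c,1]$, where $c=\tfrac12$, with $f(1-x)=f(x)$ for all $x$, and scaled so that $f(c)=1$. (It is not required that $f(0)=0$.) The increasing symmetric Lorenz map obtained from $f$ is $\varphi(x)=f(x)$ for $x\in[0,c]$ and $\varphi(x)=1-f(x)$ for $x\in(c,1]$. The decreasing symmetric Lorenz map obtained from $f$ is $\psi(x)=1-\varphi(x)$, i.e. $\psi(x)=1-f(x)$ for $x\in[0,c]$ and $\psi(x)=f(x)$ for $x\in(c,1]$. A point $x$ has prime period $n$ for a map $g$ if $g^n(x)=x$ and $g^k(x)\neq x$ for $1\le k<n$. The Sharkovsky order on the positive integers is $$1\prec 2\prec 4\prec 8\prec\dots\prec 4\cdot 7\prec 4\cdot 5\prec 4\cdot 3\prec\dots\prec 2\cdot 7\prec 2\cdot 5\prec 2\cdot 3\prec\dots\prec 7\prec 5\prec 3.$$ *)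

(* Defs.v *)
From mathcomp Require Import all_boot all_order all_algebra.
From mathcomp Require Import all_classical all_reals all_analysis.
Import Order.TTheory GRing.Theory Num.Theory.
Import numFieldNormedType.Exports.

Set Implicit Arguments.
Unset Strict Implicit.
Unset Printing Implicit Defensive.

Local Open Scope classical_set_scope.
Local Open Scope ring_scope.

(* Self-maps of [0, 1] are represented by total functions R -> R; their values
   outside [0, 1] are irrelevant. *)
Record symmetric_unimodal (R : realType) (f : R -> R) : Prop := {
  unimodal_maps : forall x, x \in `[0, 1] -> f x \in `[0, 1];
  unimodal_continuous : {within `[0, 1], continuous f};
  unimodal_increasing : {in `[0, 2^-1] &, forall x y, x < y -> f x < f y};
  unimodal_decreasing : {in `[2^-1, 1] &, forall x y, x < y -> f y < f x};
  unimodal_symmetric : {in `[0, 1], forall x, f (1 - x) = f x};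
  unimodal_top : f 2^-1 = 1
}.

Definition increasing_lorenz (R : realType) (f : R -> R) (x : R) : R :=
  if x <= 2^-1 then f x else 1 - f x.

Definition decreasing_lorenz (R : realType) (f : R -> R) (x : R) : R :=
  1 - increasing_lorenz f x.

Definition has_prime_period (T : Type) (g : T -> T) (n : nat) (x : T) : Prop :=
  [/\ (0 < n)%N, iter n g x = x
    & forall k : nat, (1 <= k < n)%N -> iter k g x <> x].

(* [sharkovsky m n] means that m strictly precedes n in the order in which 3 is the greatest element
   and 1 the least.  It is false if m or n is 0. *)
Inductive sharkovsky : nat -> nat -> Prop :=
| Sharkovsky_pow2 a b :
    (a < b)%N -> sharkovsky (2 ^ a) (2 ^ b)
| Sharkovsky_pow2_odd a b q :
    odd q -> (1 < q)%N -> sharkovsky (2 ^ a) (2 ^ b * q)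
| Sharkovsky_block a b p q :
    odd p -> (1 < p)%N -> odd q -> (1 < q)%N -> (b < a)%N ->
    sharkovsky (2 ^ a * p) (2 ^ b * q)
| Sharkovsky_odd a p q :
    odd p -> odd q -> (1 < q)%N -> (q < p)%N ->
    sharkovsky (2 ^ a * p) (2 ^ a * q).

(* Main.v *)
Require Import Defs.
From mathcomp Require Import all_boot all_order all_algebra.
From mathcomp Require Import all_classical all_reals all_analysis.
From mathcomp Require Import lra zify.
Import Order.TTheory GRing.Theory Num.Theory.
Import numFieldNormedType.Exports.
Local Open Scope ring_scope.

Set Implicit Arguments.
Unset Strict Implicit.
Unset Printing Implicit Defensive.

(** Measured from the turning point, a symmetric unimodal map is
    [f x = g `|x|] for a decreasing homeomorphism [g] of the line, and the
    decreasing Lorenz map [psi] is [g x] for positive [x] and [- g (- x)]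
    otherwise.  The two maps have the same absolute values along orbits, so that
    [psi^k x] is [f^k x] up to a sign, which is the parity of the number of
    negative points among [x, ..., f^(k-1) x] ([iter_unfold_sign]).  Hence an
    orbit of [f] of period [m] that avoids the turning point and has an even
    number of negative points is an orbit of [psi] of period [m]
    ([unfold_prime_period]), while an orbit of [psi] of period [n] folds onto an
    orbit of [f] of period [n] or [n / 2] ([fold_period_of_unfold]).  What has to
    be proved is therefore Sharkovsky's theorem for [f], for periods that are not
    powers of two, with control of that parity ([fold_map_forcing]).

    Let [z > 0] be the fixed point of [g] and [a = g (g 0)], the second image of
    the turning point, which bounds from below all periodic orbits other than
    fixed points.  Call the map deep if [a < - z], shallow otherwise.

    In the deep case let [w k] be the [k]-th preimage of the turning point along
    the positive side.  These points spiral towards [z] and bound the sets of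
    points that stay positive for a given number of steps.  If
    [f a < w (m - 3)], the intermediate value theorem gives orbits of period [m]
    whose signs are [+-+...+] (one negative point) and [+-+...+-] (two of them);
    see [forcing_loop], [one_negative_orbit] and [two_negative_orbit].  For odd
    [m] they realize both parities.  For even [m] the inequality holds
    automatically, and the second orbit suffices as soon as [m >= 5].  For odd
    [m] the inequality follows from an orbit of odd period [q < m], [q > 1]
    ([odd_orbit_depth]): such an orbit has a point [y] with both [y] and [f y]
    below [z]; then [y < 0] and [f a <= f y < z], and if [w (m - 3) <= f a], then
    [f y] stays nonnegative for at least [q] steps and cannot return to [y].

    In the shallow case every orbit of period greater than one alternates between
    the two sides of [z].  Its period is even, and [f^2] near the turning point
    is, up to [x |-> - x], the fold map of [- g (g x)], which is again a
    decreasing homeomorphism.  This halves all periods, so that induction on the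
    power of two in the given period reduces to the deep case.  Under this
    renormalization the numbers of negative points of corresponding orbits add up
    to the halved period ([unrenormalized_orbit]); this exchanges the two
    parities when the halved period is odd, which is why both are carried through
    the induction. *)

(** * Prime periods *)
Section PrimePeriod.
Context (T : Type) (g : T -> T).
Implicit Types (x : T) (n k i : nat).

Lemma iter_mul_period n x : iter n g x = x -> forall k, iter (k * n) g x = x.
Proof.
by move=> gnx; elim=> [//|k IHk]; rewrite mulSn iterD IHk.
Qed.

Lemma iter_mod_period n x : iter n g x = x ->
  forall i, iter (i %% n) g x = iter i g x.
Proof.
move=> gnx i; rewrite [in RHS](divn_eq i n) addnC iterD.
by rewrite (iter_mul_period gnx).
Qed.

Lemma prime_period_iter n x j :
  has_prime_period g n x -> has_prime_period g n (iter j g x).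
Proof.
case=> n_gt0 gnx ltn; split=> // [|k k_lt_n gk].
  by rewrite -iterD addnC iterD gnx.
apply: (ltn k k_lt_n).
have jn : (j * n = (j * n - j) + j)%N by rewrite subnK // leq_pmulr.
have := congr1 (iter (j * n - j) g) gk.
rewrite -[RHS]iterD -jn -(iterD k j) -iterD addnCA -jn iterD.
by rewrite (iter_mul_period gnx).
Qed.

Lemma prime_period_dvdn n x k :
  has_prime_period g n x -> iter k g x = x -> (n %| k)%N.
Proof.
case=> n_gt0 gnx ltn gkx; rewrite /dvdn -[_ == _]negbK -lt0n.
apply/negP => rem_gt0; apply: (ltn (k %% n)%N).
  by rewrite rem_gt0 ltn_pmod.
by rewrite iter_mod_period.
Qed.

End PrimePeriod.

(** * Fixed points between two points *)

(** The points compared below spiral around a fixed point, so that their order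
    depends on the parity of an index; the symmetric formulation avoids this case
    distinction. *)
Definition strictly_between (R : realType) (p q y : R) : bool :=
  (p < y < q) || (q < y < p).

Lemma fixed_point_between (R : realType) (F : R -> R) (p q : R) :
  continuous F -> p < F p -> F q < q ->
  exists2 x, F x = x & strictly_between p q x.
Proof.
move=> cF ltp ltq.
have cD : continuous (fun x => F x - x).
  by move=> x; apply: continuousB; [exact: cF|].
have [D0p Dq0] : 0 < F p - p /\ F q - q < 0 by rewrite subr_gt0 subr_lt0.
have D0 : Num.min (F p - p) (F q - q) <= 0 <= Num.max (F p - p) (F q - q).
  by rewrite ge_min le_max (ltW D0p) (ltW Dq0) orbT.
have [lt_pq|lt_qp|epq] := ltgtP p q; last by move: ltq; rewrite -epq ltNge ltW.
- have [x] := IVT (ltW lt_pq) (continuous_subspaceT cD) D0.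
  rewrite in_itv /= => /andP[px xq] /eqP; rewrite subr_eq0 => /eqP Fx.
  exists x => //; apply/orP; left; rewrite !lt_neqAle px xq !andbT.
  apply/andP; split; apply/eqP => e.
    by move: ltp; rewrite e Fx ltxx.
  by move: ltq; rewrite -e Fx ltxx.
- rewrite minC maxC in D0.
  have [x] := IVT (ltW lt_qp) (continuous_subspaceT cD) D0.
  rewrite in_itv /= => /andP[qx xp] /eqP; rewrite subr_eq0 => /eqP Fx.
  exists x => //; apply/orP; right; rewrite !lt_neqAle qx xp !andbT.
  apply/andP; split; apply/eqP => e.
    by move: ltq; rewrite e Fx ltxx.
  by move: ltp; rewrite -e Fx ltxx.
Qed.

(** * Fold maps of decreasing homeomorphisms *)

(** Working on the whole line removes every domain condition: the inverse of [g]
    is total, and the class is stable under renormalization. *)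
Record decreasing_homeo (R : realType) (g : R -> R) : Prop := {
  homeo_continuous : continuous g;
  homeo_decreasing : forall x y, x < y -> g y < g x;
  homeo_bijective : bijective g
}.

Definition fold_map (R : realType) (g : R -> R) (x : R) : R := g `|x|.

Section FoldMap.
Context (R : realType) (g : R -> R) (hg : decreasing_homeo g).
Implicit Types (x y z : R) (n i : nat).
Local Notation f := (fold_map g).

Lemma homeo_lt x y : (g x < g y) = (y < x).
Proof.
have [lt_xy|lt_yx|->] := ltgtP x y; last by rewrite ltxx.
  by apply/negbTE; rewrite -leNgt ltW // homeo_decreasing.
by rewrite homeo_decreasing.
Qed.

Lemma homeo_le x y : (g x <= g y) = (y <= x).
Proof. by rewrite leNgt homeo_lt -leNgt. Qed.

Lemma fold_map_nonneg x : 0 <= x -> f x = g x.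
Proof. by move=> x0; rewrite /fold_map ger0_norm. Qed.

Lemma fold_map_nonpos x : x <= 0 -> f x = g (- x).
Proof. by move=> x0; rewrite /fold_map ler0_norm. Qed.

Lemma fold_map_le_peak x : f x <= g 0.
Proof. by rewrite homeo_le. Qed.

Lemma fold_map_continuous : continuous f.
Proof.
move=> x; apply: continuous_comp; first exact: norm_continuous.
exact: homeo_continuous.
Qed.

Lemma iter_fold_map_continuous n : continuous (iter n f).
Proof.
elim: n => [|n IHn] x; first exact: cvg_id.
apply: (@continuous_comp _ _ _ (iter n f) f); first exact: IHn.
exact: fold_map_continuous.
Qed.

(** The least point of a periodic orbit is the image of a positive point: on the
    nonpositive side [fold_map g] is increasing, so if the least point [v] were
    the image of [u <= 0], then [v <= u] would give [f v <= f u = v], making [v]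
    a fixed point.  This confines the orbit to the interval of [orbit_bounds]. *)
Lemma orbit_min_preimage n x : has_prime_period f n x -> (1 < n)%N ->
  exists2 j, 0 < iter j f x & forall i, iter j.+1 f x <= iter i f x.
Proof.
move=> perx n_gt1; have [n_gt0 fnx _] := perx.
pose i0 := [arg min_(i < Ordinal n_gt0) iter i f x]%O.
have min_i0 i : iter i0 f x <= iter i f x.
  rewrite -(iter_mod_period fnx i) /i0; case: arg_minP => // k _ kmin.
  exact: (kmin (Ordinal (ltn_pmod i n_gt0))).
have next_i0 : iter (i0 + n.-1).+1 f x = iter i0 f x.
  by rewrite -addnS prednK // iterD fnx.
exists (i0 + n.-1)%N => [|i]; last by rewrite next_i0.
rewrite ltNge; apply/negP => u_le0.
rewrite iterS in next_i0.
set u := iter (_ + _) f x in next_i0 u_le0; set v := iter i0 f x in next_i0 min_i0.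
have v_le_u : v <= u by exact: min_i0.
have fu : g (- u) = v by rewrite -fold_map_nonpos.
have fv : f v = v.
  apply: le_anti; rewrite (min_i0 i0.+1) andbT -[leRHS]fu.
  by rewrite fold_map_nonpos ?(le_trans v_le_u) // homeo_le lerN2.
by have [_ _ /(_ 1%N)] := prime_period_iter i0 perx; apply.
Qed.

Lemma orbit_bounds n x i : has_prime_period f n x -> (1 < n)%N ->
  g (g 0) <= iter i f x <= g 0.
Proof.
move=> perx n_gt1; have [n_gt0 fnx _] := perx.
have le_peak k : iter k f x <= g 0.
  rewrite -[x]fnx -iterD -(prednK n_gt0) addnS; exact: fold_map_le_peak.
have [j pos_j min_j] := orbit_min_preimage perx n_gt1.
rewrite le_peak andbT (le_trans _ (min_j i)) //= fold_map_nonneg ?(ltW pos_j) //.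
by rewrite homeo_le.
Qed.

Lemma peak_gt0 n x : has_prime_period f n x -> (1 < n)%N -> 0 < g 0.
Proof.
move=> perx n_gt1; have [j pos_j _] := orbit_min_preimage perx n_gt1.
by apply: (lt_le_trans pos_j); have /andP[] := orbit_bounds j perx n_gt1.
Qed.

Lemma positive_fixed_point : 0 < g 0 -> exists2 z, 0 < z & g z = z.
Proof.
move=> h_gt0.
have [z gz] : exists2 z, g z = z & strictly_between 0 (g 0) z.
  apply: fixed_point_between => //; first exact: homeo_continuous.
  by rewrite homeo_lt.
by case/orP => /andP[z0 z1]; exists z => //; exact: lt_trans z0.
Qed.

(** A point above the fixed point of [g] is always mapped below it; the last
    hypothesis supplies the other half of the alternation. *)
Lemma orbit_alternates n x z : has_prime_period f n x -> (1 < n)%N ->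
    0 <= z -> g z = z ->
    (forall i, (z <= iter i f x) || (z <= iter i.+1 f x)) ->
  forall i, (iter i f x < z) = odd i (+) (x < z).
Proof.
move=> perx n_gt1 z_ge0 gz alt; elim=> [//|i IHi].
have neq_z : iter i f x != z.
  apply/eqP => eq_z; have [_ _ /(_ 1%N)] := prime_period_iter i perx.
  by apply => //=; rewrite eq_z fold_map_nonneg.
rewrite oddS addNb -IHi; have [lt_z|ge_z] := ltP (iter i f x) z.
  by have := alt i; rewrite leNgt lt_z /= leNgt => /negbTE.
have gt_z : z < iter i f x by rewrite lt_neqAle eq_sym neq_z.
by rewrite iterS fold_map_nonneg ?(le_trans z_ge0) // -[ltRHS]gz homeo_lt.
Qed.

End FoldMap.

(** * Itineraries *)
Definition negative_visits (R : realType) (F : R -> R) (m : nat) (x : R) : nat :=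
  (\sum_(0 <= i < m) (iter i F x < 0)%R)%N.

(** [P] marks the times at which the orbit is negative; the turning point is
    excluded. *)
Definition has_itinerary (R : realType) (F : R -> R) (m : nat) (P : pred nat)
    (x : R) : Prop :=
  forall i, (i < m)%N -> if P i then iter i F x < 0 else 0 < iter i F x.

Section Itinerary.
Context (R : realType) (F : R -> R) (m : nat) (P : pred nat) (x : R).
Context (word : has_itinerary F m P x).

Lemma itinerary_sign i : (i < m)%N -> (iter i F x < 0) = P i.
Proof.
move=> lt_i; have := word lt_i; case: (P i) => [->//|pos].
by rewrite ltNge ltW.
Qed.

Lemma itinerary_neq0 : (0 < m)%N -> iter m F x = x -> forall i, iter i F x != 0.
Proof.
move=> m_gt0 Fx i; rewrite -(iter_mod_period Fx).
have := word (ltn_pmod i m_gt0).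
by case: (P _) => [/ltr0_neq0|/lt0r_neq0].
Qed.

Lemma itinerary_negative_visits :
  negative_visits F m x = (\sum_(0 <= i < m) P i)%N.
Proof. by apply: eq_big_nat => i /andP[_ lt_i]; rewrite itinerary_sign. Qed.

End Itinerary.

(** * Deep fold maps *)

(** [r] stands for the inverse of the homeomorphism [g]. *)
Definition turning_preimage (R : realType) (r : R -> R) (k : nat) : R :=
  iter k r 0.

(** For [y] below the peak, the preimage of [y] under the second iterate that lies
    to the right of [r 0], so that its first image is negative. *)
Definition second_preimage (R : realType) (r : R -> R) (y : R) : R := r (- r y).

Section DeepFold.
Context (R : realType) (g r : R -> R) (z : R).
Context (hg : decreasing_homeo g) (gK : cancel g r) (rK : cancel r g).
Context (z_gt0 : 0 < z) (gz : g z = z) (deep : g (g 0) < - z).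
Implicit Types (x y : R) (n k i : nat).
Local Notation f := (fold_map g).
Local Notation w := (turning_preimage r).

Lemma strictly_between_homeo p q y :
  strictly_between (g p) (g q) (g y) = strictly_between p q y.
Proof.
rewrite /strictly_between !(homeo_lt hg) orbC andbC.
by congr (_ || _); rewrite andbC.
Qed.

Lemma strictly_between_gt0 (p q y : R) :
  0 <= p -> 0 <= q -> strictly_between p q y -> 0 < y.
Proof.
move=> p0 q0 /orP[] /andP[lt_y _]; [exact: le_lt_trans p0 lt_y|].
exact: le_lt_trans q0 lt_y.
Qed.

Lemma inverse_lt x y : (r x < r y) = (y < x).
Proof. by rewrite -(homeo_lt hg) !rK. Qed.

Lemma inverse_le x y : (r x <= r y) = (y <= x).
Proof. by rewrite -(homeo_le hg) !rK. Qed.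

Lemma fixed_point_lt_peak : z < g 0.
Proof.
by rewrite -(homeo_lt hg) gz (lt_trans deep) // gtrN.
Qed.

Lemma fixed_point_lt_r0 : z < r 0.
Proof. by rewrite -(homeo_lt hg) rK gz. Qed.

Lemma peak_image_lt0 : g (g 0) < 0.
Proof. by rewrite (lt_trans deep) // oppr_lt0. Qed.

Lemma r0_lt_peak : r 0 < g 0.
Proof. by rewrite -(homeo_lt hg) rK peak_image_lt0. Qed.

Lemma preimage_bounds k : 0 <= w k <= r 0.
Proof.
have r0_gt0 : 0 < r 0 := lt_trans z_gt0 fixed_point_lt_r0.
elim: k => [|k /andP[ge0 le_r0]]; first by rewrite lexx ltW.
rewrite -[w k.+1]/(r (w k)) inverse_le ge0 andbT.
by rewrite -(gK 0) inverse_le (le_trans le_r0) // ltW // r0_lt_peak.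
Qed.

Lemma preimage_ge0 k : 0 <= w k.
Proof. by have /andP[] := preimage_bounds k. Qed.

Lemma preimage_lt_peak k : w k < g 0.
Proof.
have /andP[_ le_r0] := preimage_bounds k.
exact: le_lt_trans le_r0 r0_lt_peak.
Qed.

Lemma g_preimage k : g (w k.+1) = w k.
Proof. exact: rK. Qed.

Lemma iter_preimage k j : iter k f (w (k + j)) = w j.
Proof.
elim: k => [//|k IHk]; rewrite addSn iterSr.
by rewrite fold_map_nonneg ?preimage_ge0 // g_preimage.
Qed.

Lemma preimage_side k : if odd k then z < w k else w k < z.
Proof.
elim: k => [//|k]; rewrite oddS.
by case: (odd k) => /= lt_k; rewrite -(homeo_lt hg) g_preimage gz.
Qed.

(** Since [g] maps [w k.+1] to [w k] and fixes [z], each step lowers the index by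
    one while staying on the nonnegative side, down to [w 0 = 0]. *)
Lemma cylinder_at_fixed_point k y :
    (w k <= y <= z) || (z <= y <= w k) ->
  forall i, (i <= k)%N -> 0 <= iter i f y.
Proof.
elim: k y => [|k IHk] y y_in i.
  rewrite leqn0 => /eqP -> /=.
  case/orP: y_in => /andP[ge le] //.
  exact: le_trans (ltW z_gt0) ge.
have y_ge0 : 0 <= y.
  case/orP: y_in => /andP[ge _]; last exact: le_trans (ltW z_gt0) ge.
  exact: le_trans (preimage_ge0 _) ge.
case: i => [//|i] lt_i; rewrite iterSr; apply: IHk => //.
rewrite fold_map_nonneg // -(g_preimage k) -gz !(homeo_le hg) orbC.
by rewrite andbC [X in _ || X]andbC.
Qed.

(** The same descent between two of the points [w], both of whose indices drop by
    one at each step. *)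
Lemma cylinder_between j k k' y :
    strictly_between (w (j + k)) (w (j + k')) y ->
  strictly_between (w k) (w k') (iter j f y)
  /\ forall i, (i <= j)%N -> 0 < iter i f y.
Proof.
elim: j y => [|j IHj] y y_in.
  split=> // i; rewrite leqn0 => /eqP -> /=.
  by apply: strictly_between_gt0 y_in; exact: preimage_ge0.
have y_gt0 : 0 < y.
  by apply: strictly_between_gt0 y_in; exact: preimage_ge0.
have [|fy_in pos] := IHj (f y).
  rewrite fold_map_nonneg ?(ltW y_gt0) // -(g_preimage (j + k)).
  rewrite -(g_preimage (j + k')) strictly_between_homeo.
  by rewrite -!addSn.
rewrite iterSr; split=> // -[//|i] lt_i; rewrite iterSr; exact: pos.
Qed.

Lemma second_preimage_gt_r0 y : y < g 0 -> r 0 < second_preimage r y.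
Proof. by rewrite /second_preimage inverse_lt oppr_lt0 -(gK 0) inverse_lt gK. Qed.

Lemma fold_fold_second_preimage y : y < g 0 -> f (f (second_preimage r y)) = y.
Proof.
move=> lt_y; have r0_gt0 : 0 < r 0 := lt_trans z_gt0 fixed_point_lt_r0.
have ry_gt0 : 0 < r y by rewrite -(gK 0) inverse_lt.
rewrite [f (second_preimage r y)]fold_map_nonneg; last first.
  exact: ltW (lt_trans r0_gt0 (second_preimage_gt_r0 lt_y)).
by rewrite rK fold_map_nonpos ?oppr_le0 ?ltW // opprK rK.
Qed.

(** The two ends of the interval are chosen so that two steps lead to [w (n + d)]
    and [w n].  The first then reaches the turning point just before the last
    step and ends at the peak; the second reaches it [d] steps earlier and ends
    at [f^(d+1) 0], which is small.  So [f^(n+d+3)] moves them in opposite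
    directions.  The bound on [f a], where [a = g (g 0)], says that the first
    endpoint lies below the peak. *)
Lemma forcing_loop n d :
    g (- g (g 0)) < w (n + d) -> iter d.+1 f 0 <= z ->
  exists x, [/\ iter (n + d + 3) f x = x, 0 < x, f x < 0
              & strictly_between (w n) (w (n + d)) (f (f x))].
Proof.
move=> lt_w le_z.
pose e1 := second_preimage r (w (n + d)); pose e2 := second_preimage r (w n).
have r0_gt0 : 0 < r 0 := lt_trans z_gt0 fixed_point_lt_r0.
have e1_gt : r 0 < e1 by exact/second_preimage_gt_r0/preimage_lt_peak.
have e2_gt : r 0 < e2 by exact/second_preimage_gt_r0/preimage_lt_peak.
have fe1 : iter (n + d + 3) f e1 = g 0.
  have -> : (n + d + 3 = 1 + ((n + d) + 2))%N by lia.
  rewrite iterD [iter (_ + 2) _ _]iterD [iter 2 _ _]fold_fold_second_preimage.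
    2: exact: preimage_lt_peak.
  by have := iter_preimage (n + d) 0; rewrite addn0 => ->; rewrite /= fold_map_nonneg.
have fe2 : iter (n + d + 3) f e2 = iter d.+1 f 0.
  have -> : (n + d + 3 = d.+1 + (n + 2))%N by lia.
  rewrite iterD [iter (_ + 2) _ _]iterD [iter 2 _ _]fold_fold_second_preimage.
    2: exact: preimage_lt_peak.
  by have := iter_preimage n 0; rewrite addn0 => ->.
have [|||x fx x_in] := @fixed_point_between R (iter (n + d + 3) f) e1 e2.
- exact: iter_fold_map_continuous.
- by rewrite fe1 -(homeo_lt hg) rK ltrNr -(gK (- _)) inverse_lt.
- by rewrite fe2 (le_lt_trans le_z) // (lt_trans fixed_point_lt_r0).
have x_gt : r 0 < x by case/orP: x_in => /andP[lt_x _]; apply: lt_trans lt_x.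
have x_gt0 : 0 < x by exact: lt_trans x_gt.
have fx_lt0 : f x < 0 by rewrite fold_map_nonneg ?ltW // -(rK 0) (homeo_lt hg).
exists x; split=> //.
have <- : f (f e1) = w (n + d) by exact/fold_fold_second_preimage/preimage_lt_peak.
have <- : f (f e2) = w n by exact/fold_fold_second_preimage/preimage_lt_peak.
have ff u : r 0 < u -> f (f u) = g (- g u).
  move=> lt_u; rewrite [f u]fold_map_nonneg ?ltW ?(lt_trans r0_gt0) //.
  by rewrite fold_map_nonpos // -(rK 0) (homeo_le hg) ltW.
rewrite !ff // strictly_between_homeo /strictly_between !ltrN2.
rewrite [X in X || _]andbC [X in _ || X]andbC -/(strictly_between _ _ _).
by rewrite strictly_between_homeo /strictly_between.
Qed.

Lemma between_0_preimage j y : strictly_between 0 (w j) y -> 0 < y < w j.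
Proof.
case/orP => // /andP[lt_y y_lt0].
by have := lt_trans lt_y y_lt0; rewrite ltNge preimage_ge0.
Qed.

(** The case [d = 1].  A sign sequence with a single minus has no smaller
    period. *)
Lemma one_negative_orbit n : g (- g (g 0)) < w (n + 1) ->
  exists x, [/\ has_prime_period f (n + 4) x, forall i, iter i f x != 0
              & negative_visits f (n + 4) x = 1%N].
Proof.
move=> lt_w.
have [|x [fx x_gt0 fx_lt0 ffx]] := forcing_loop lt_w.
  rewrite /= [f 0]fold_map_nonneg // fold_map_nonneg.
    exact: ltW (lt_trans peak_image_lt0 z_gt0).
  exact: ltW (lt_trans z_gt0 fixed_point_lt_peak).
rewrite -addnA in fx; rewrite -[n in w n]addn0 in ffx.
have [/between_0_preimage/andP[_ last_lt] pos] := cylinder_between ffx.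
have word : has_itinerary f (n + 4) (pred1 1%N) x.
  case=> [|[|i]] //= lt_i; rewrite -!iterS !iterSr.
  have [le_i|lt_n] := leqP i n; first exact: pos.
  have -> : i = n.+1 by apply/eqP; move: lt_i; rewrite addn4 !ltnS eqn_leq lt_n => ->.
  by rewrite iterS fold_map_nonneg ?ltW ?pos // -(rK 0) (homeo_lt hg).
have m_gt0 : (0 < n + 4)%N by rewrite addnS.
exists x; split; last 1 first.
- rewrite (itinerary_negative_visits word).
  by rewrite addn4 2?big_ltn // big1_seq // => i; rewrite mem_index_iota; case: i => [|[|]].
- split=> // -[//|k] /andP[_ lt_k] fkx.
  have lt0 : iter k.+2 f x < 0 by rewrite iterS fkx.
  have [lt_k1|ge_k1] := ltnP k.+2 (n + 4).
    by have /= := word _ lt_k1; rewrite ltNge ltW.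
  have k1 : k.+2 = (n + 4)%N by apply/eqP; rewrite eqn_leq lt_k ge_k1.
  by move: lt0; rewrite k1 fx ltNge ltW.
- exact: itinerary_neq0 word m_gt0 fx.
Qed.

(** The case [d = 2].  The two minus signs are adjacent up to one plus in the
    cyclic order and at distance more than two the other way round, since the
    period is at least five; so there is no smaller period. *)
Lemma two_negative_orbit n :
    g (- g (g 0)) < w (n + 2) -> g (- g (g 0)) <= z ->
  exists x, [/\ has_prime_period f (n + 5) x, forall i, iter i f x != 0
              & negative_visits f (n + 5) x = 2%N].
Proof.
move=> lt_w le_z.
have [|x [fx x_gt0 fx_lt0 ffx]] := forcing_loop lt_w.
  rewrite /= [f 0]fold_map_nonneg // [f (g 0)]fold_map_nonneg.
    by rewrite fold_map_nonpos // ltW // peak_image_lt0.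
  exact: ltW (lt_trans z_gt0 fixed_point_lt_peak).
rewrite -addnA in fx; rewrite -[n in w n]addn0 in ffx.
have [/between_0_preimage/andP[_ last_lt] pos] := cylinder_between ffx.
have r0_lt : r 0 < iter n.+1 f (f (f x)).
  by rewrite iterS fold_map_nonneg ?ltW ?pos // -(rK (r 0)) (homeo_lt hg).
have r0_gt0 : 0 < r 0 := lt_trans z_gt0 fixed_point_lt_r0.
pose P i := (i == 1%N) || (i == n + 4)%N.
have word : has_itinerary f (n + 5) P x.
  case=> [|[|i]] lt_i; rewrite /P //=; first by rewrite addn4 /=.
  rewrite -!iterS !iterSr addn4 !eqSS.
  have [le_i|lt_n] := leqP i n; first by rewrite ltn_eqF ?pos //; exact: leqW.
  have [->|neq_i] := eqVneq i n.+2; last first.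
    have -> : i = n.+1.
      apply/eqP; move: lt_i; rewrite addnS addn4 !ltnS leq_eqVlt (negPf neq_i).
      by rewrite /= ltnS eqn_leq lt_n => ->.
    exact: lt_trans r0_gt0 r0_lt.
  rewrite iterS fold_map_nonneg; first by rewrite -(rK 0) (homeo_lt hg).
  exact: ltW (lt_trans r0_gt0 r0_lt).
have m_gt0 : (0 < n + 5)%N by rewrite addnS.
exists x; split; last 1 first.
- rewrite (itinerary_negative_visits word) addnS big_nat_recr //=.
  rewrite addn4 2?big_ltn // big_nat big1 => [|i /andP[]]; rewrite /P addn4.
    by rewrite !eqxx orbT.
  by case: i => [|[|i]] // _ lt_i; rewrite /= ltn_eqF.
- split=> // -[//|k] /andP[_ lt_k] fkx.
  have lt0 : iter k.+2 f x < 0 by rewrite iterS fkx.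
  have [lt_k1|ge_k1] := ltnP k.+2 (n + 5); last first.
    have k1 : k.+2 = (n + 5)%N by apply/eqP; rewrite eqn_leq lt_k ge_k1.
    by move: lt0; rewrite k1 fx ltNge ltW.
  have := word _ lt_k1; rewrite /P /= -!iterS.
  have [k1 _|_] := eqVneq; last by rewrite ltNge ltW.
  have k_eq : (n + 4 + k.+1 = n + 2 + (n + 5))%N by clear -k1; lia.
  have lt4 : (n + 4 < n + 5)%N by rewrite ltn_add2l.
  have lt2 : (n + 2 < n + 5)%N by rewrite ltn_add2l.
  have eq_x : iter (n + 4) f x = iter (n + 2) f x.
    by rewrite -{1}fkx -iterD k_eq iterD fx.
  have := word _ lt4; rewrite /P eqxx orbT eq_x => neg.
  have := word _ lt2; rewrite /P eqn_add2l addn2 /= => /(lt_trans neg).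
  by rewrite addn2 ltxx.
- exact: itinerary_neq0 word m_gt0 fx.
Qed.

Lemma fold_fold_peak_lt : g (- g (g 0)) < z.
Proof. by rewrite -[ltRHS]gz (homeo_lt hg) ltrNr. Qed.

(** An orbit of odd period cannot alternate around [z], so it has two successive
    points [y] and [f y] below [z].  This forces [y < - z], hence
    [f a <= f y < z] with [a = g (g 0)].  If [w k <= f a], the cylinder lemma
    makes [f y] stay nonnegative long enough to contradict [f^q y = y < 0]. *)
Lemma odd_orbit_depth q x k : has_prime_period f q x -> (1 < q)%N -> odd q ->
  ~~ odd k -> (q <= k.+1)%N -> g (- g (g 0)) < w k.
Proof.
move=> perx q_gt1 q_odd k_even le_q; rewrite ltNge; apply/negP => w_le.
have [_ fqx _] := perx.
have [i lt_i lt_Si] : exists2 i, iter i f x < z & iter i.+1 f x < z.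
  apply: contrapT => no_i.
  have alt i : (z <= iter i f x) || (z <= iter i.+1 f x).
    rewrite !leNgt -negb_and; apply/negP => /andP[lt_i lt_Si].
    by apply: no_i; exists i.
  have := orbit_alternates hg perx q_gt1 (ltW z_gt0) gz alt q.
  by rewrite fqx q_odd; case: (x < z).
have pery := prime_period_iter i perx; set y := iter i f x in lt_i pery.
have lt_fy : f y < z by [].
have lt_ny : z < `|y| by rewrite -(homeo_lt hg) gz.
have y_lt0 : y < 0.
  by rewrite ltNge; apply/negP => y_ge0; move: lt_ny; rewrite ger0_norm // ltNge ltW.
have /andP[ge_y _] := orbit_bounds hg 0 pery q_gt1.
have fy_in : (w k <= f y <= z) || (z <= f y <= w k).
  rewrite (ltW lt_fy) andbT (le_trans w_le) // fold_map_nonpos ?(ltW y_lt0) //.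
  by rewrite (homeo_le hg) lerN2.
have [_ fqy _] := pery.
have le_q' : (q.-1 <= k)%N by rewrite -ltnS prednK // ltnW.
have := cylinder_at_fixed_point fy_in le_q'.
by rewrite -iterSr prednK ?(ltnW q_gt1) // fqy leNgt y_lt0.
Qed.

End DeepFold.

(** * Shallow fold maps and renormalization *)
Section ShallowFold.
Context (R : realType) (g : R -> R) (z : R).
Context (hg : decreasing_homeo g).
Context (z_gt0 : 0 < z) (gz : g z = z) (shallow : - z <= g (g 0)).
Implicit Types (x y : R) (n k i : nat).
Local Notation f := (fold_map g).

Definition renormalization (x : R) : R := - g (g x).
Local Notation G := renormalization.
Local Notation F := (fold_map G).

Lemma renormalization_homeo : decreasing_homeo G.
Proof.
have [cg _ bg] := hg; split=> [x|x y lt_xy|].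
- apply: continuousN; apply: (@continuous_comp _ _ _ g g); exact: cg.
- by rewrite ltrN2 !(homeo_lt hg).
- by apply: (@bij_comp _ _ _ -%R (g \o g)); [exists -%R; exact: opprK|exact: bij_comp].
Qed.

Lemma fold_map_ge_fixed y : `|y| <= z -> z <= f y.
Proof. by rewrite -{2}gz (homeo_le hg). Qed.

Lemma fold_map_gt_fixed y : `|y| < z -> z < f y.
Proof. by rewrite -{2}gz (homeo_lt hg). Qed.

(** The sign is that of the conjugacy [x |-> - x]; it turns the minimum of [f^2]
    at the turning point into a maximum. *)
Lemma fold_renormalization y : `|y| <= z -> F (- y) = - f (f y).
Proof.
move=> y_le; rewrite [f (f y)]fold_map_nonneg; first by rewrite /fold_map normrN.
exact: le_trans (ltW z_gt0) (fold_map_ge_fixed y_le).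
Qed.

Lemma shallow_orbit_alternates n x : has_prime_period f n x -> (1 < n)%N ->
  forall i, (iter i f x < z) = odd i (+) (x < z).
Proof.
move=> perx n_gt1; apply: (orbit_alternates hg perx n_gt1 (ltW z_gt0) gz) => i.
have [//|lt_z] := leP z (iter i f x); apply: fold_map_ge_fixed.
have /andP[ge_y _] := orbit_bounds hg i perx n_gt1.
by rewrite ler_norml (ltW lt_z) (le_trans shallow).
Qed.

Lemma shallow_period_even n x :
  has_prime_period f n x -> (1 < n)%N -> ~~ odd n.
Proof.
move=> perx n_gt1; have := shallow_orbit_alternates perx n_gt1 n.
by have [_ -> _] := perx; case: (odd n) (x < z) => [] [].
Qed.

(** Every other point of the orbit lies below [z], and all of these are within
    the range [`|y| <= z] on which [fold_renormalization] applies. *)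
Lemma renormalized_orbit k x : has_prime_period f k.*2 x ->
  exists y, has_prime_period F k y.
Proof.
move=> perx; have [k2_gt0 _ _] := perx.
have k_gt0 : (0 < k)%N by rewrite -double_gt0.
have k2_gt1 : (1 < k.*2)%N by rewrite -ltn_half_double.
wlog lt_x : x perx / x < z => [hwlog|].
  have [|ge_x] := ltP x z; first exact: hwlog.
  apply: (hwlog (f x)); first exact: (prime_period_iter 1 perx).
  by rewrite (shallow_orbit_alternates perx k2_gt1 1) ltNge ge_x.
have even_le i : `|iter i.*2 f x| <= z.
  have /andP[ge_y _] := orbit_bounds hg i.*2 perx k2_gt1.
  rewrite ler_norml (le_trans shallow) // ltW //.
  by rewrite (shallow_orbit_alternates perx k2_gt1) odd_double.
have iterF i : iter i F (- x) = - iter i.*2 f x.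
  by elim: i => [//|i IHi]; rewrite iterS IHi fold_renormalization.
have [_ fx prime] := perx.
exists (- x); split=> [//||i /andP[i_gt0 lt_i]]; first by rewrite iterF fx.
rewrite iterF => /oppr_inj; apply: prime.
by rewrite double_gt0 i_gt0 ltn_double.
Qed.

(** The renormalized map is related to [f^2] only on [`|y| <= z].  A point with
    [z <= `|y|] is sent to [- z] or below and stays there forever, while a periodic
    orbit of period greater than one has a positive point. *)
Lemma renormalized_orbit_lt k y i : has_prime_period F k y -> (1 < k)%N ->
  `|iter i F y| < z.
Proof.
move=> pery k_gt1; rewrite ltNge; apply/negP => ge_z.
have [k_gt0 Fy _] := pery.
have step u : z <= `|u| -> F u <= - z.
  by move=> le_u; rewrite lerN2 -{1}gz (homeo_le hg) -[leRHS]gz (homeo_le hg).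
have later t : iter (t.+1 + i) F y <= - z.
  elim: t => [|t IHt]; first exact: step.
  rewrite addSn iterS; apply: step; rewrite -normrN.
  by apply: le_trans (ler_norm _); rewrite lerNr.
have [j pos_j _] := orbit_min_preimage renormalization_homeo pery k_gt1.
have := later (j + i.+1 * k - i.+1)%N.
have le_i : (i.+1 <= j + i.+1 * k)%N by rewrite (leq_trans _ (leq_addl _ _)) // leq_pmulr.
rewrite addSnnS subnK // iterD (iter_mul_period Fy) leNgt.
by rewrite (lt_trans _ pos_j) // oppr_lt0.
Qed.

(** At odd times the orbit of [f] is above [z]; at even times it is the opposite
    of the renormalized orbit.  So it is negative exactly when the latter is
    positive. *)
Lemma unrenormalized_orbit k y : has_prime_period F k y -> (1 < k)%N ->
    (forall i, iter i F y != 0) ->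
  [/\ has_prime_period f k.*2 (- y), forall i, iter i f (- y) != 0
    & (negative_visits f k.*2 (- y) + negative_visits F k y = k)%N].
Proof.
move=> pery k_gt1 F_neq0; have [k_gt0 Fy prime] := pery.
have ltz i : `|iter i F y| < z by exact: renormalized_orbit_lt pery k_gt1.
have even_it i : iter i.*2 f (- y) = - iter i F y.
  elim: i => [//|i IHi]; rewrite doubleS !iterS IHi.
  by rewrite -[iter i F y in RHS]opprK fold_renormalization ?opprK ?normrN ?ltW.
have odd_gt i : z < iter i.*2.+1 f (- y).
  by rewrite iterS even_it fold_map_gt_fixed // normrN.
split.
- split=> [||d /andP[d_gt0 lt_d]]; first by rewrite double_gt0.
    by rewrite even_it Fy.
  case d_odd: (odd d) (odd_double_half d) => eq_d; rewrite -eq_d => fd.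
    have := odd_gt d./2; rewrite -add1n fd ltNge => /negP; apply.
    by rewrite (le_trans (ler_norm _)) // normrN ltW // (ltz 0).
  move: fd; rewrite add0n even_it => /oppr_inj; apply: prime.
  have lt_half : (d./2 < k)%N by clear -lt_d eq_d; lia.
  have gt_half : (0 < d./2)%N by clear -d_gt0 eq_d; lia.
  by rewrite gt_half lt_half.
- move=> i; rewrite -[i]odd_double_half; case: (odd i).
    by rewrite lt0r_neq0 // (lt_trans z_gt0) // odd_gt.
  by rewrite add0n even_it oppr_eq0.
- have main j : (negative_visits f j.*2 (- y) + negative_visits F j y = j)%N.
    elim: j => [|j IHj]; first by rewrite /negative_visits !big_geq.
    rewrite /negative_visits doubleS.
    rewrite !big_nat_recr //= -/(negative_visits _ _ _) -/(negative_visits _ _ _).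
    rewrite -!iterS even_it oppr_lt0 [iter _.+1 _ _ < 0]ltNge.
    rewrite (ltW (lt_trans z_gt0 (odd_gt j))) addn0.
    rewrite addnACA IHj -addn1; congr (_ + _)%N.
    by case: ltgtP (F_neq0 j) => //= ->; rewrite eqxx.
  exact: main.
Qed.

End ShallowFold.

(** * Forcing of periods with prescribed parity *)

(** For even [m] the number of negative points is required to be even whatever
    [e] is: with nonzero points, the numbers of negative and of positive points
    then have the same parity.  For odd [m], [e] decides which of these two
    numbers is even. *)
Definition has_signed_orbit (R : realType) (F : R -> R) (m : nat) (e : bool) : Prop :=
  exists y, [/\ has_prime_period F m y, forall i, iter i F y != 0
              & odd (negative_visits F m y) = e && odd m].

Lemma deep_forcing (R : realType) (g : R -> R) (z x : R) (a b p q : nat) (e : bool) :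
    decreasing_homeo g -> 0 < z -> g z = z -> g (g 0) < - z ->
    odd p -> (1 < p)%N -> odd q -> (1 < q)%N ->
    (b < a)%N || (a == b) && (q < p)%N ->
    has_prime_period (fold_map g) (2 ^ b * q) x ->
  has_signed_orbit (fold_map g) (2 ^ a * p) e.
Proof.
move=> hg z_gt0 gz deep p_odd p_gt1 q_odd q_gt1 lt_ba perx.
have [r gK rK] := homeo_bijective hg.
case: a lt_ba => [|a] lt_ba.
  have {}lt_ba : b = 0%N /\ (q < p)%N by case/orP: lt_ba => // /andP[/eqP <-].
  case: lt_ba perx => -> lt_qp; rewrite !expn0 !mul1n => perx.
  have depth := odd_orbit_depth hg gK rK z_gt0 gz deep perx q_gt1 q_odd.
  have p_gt : (q.+2 <= p)%N by clear -lt_qp p_odd q_odd; lia.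
  case: e.
    have [|y [pery y_neq0 visits]] := one_negative_orbit hg gK rK z_gt0 gz deep (n := p - 4).
    - by apply: depth; clear -p_gt p_odd q_gt1; lia.
    have p4 : (p - 4 + 4 = p)%N by clear -p_gt p_odd q_gt1; lia.
    rewrite p4 in pery visits.
    by exists y; rewrite visits p_odd.
  have [||y [pery y_neq0 visits]] := two_negative_orbit hg gK rK z_gt0 gz deep (n := p - 5).
  - by apply: depth; clear -p_gt p_odd q_gt1; lia.
  - exact/ltW/fold_fold_peak_lt.
  have p5 : (p - 5 + 5 = p)%N by clear -p_gt p_odd q_gt1; lia.
  rewrite p5 in pery visits.
  by exists y; rewrite visits.
have lt_z := fold_fold_peak_lt hg gz deep.
set m := (2 ^ a.+1 * p)%N.
have m_even : ~~ odd m by rewrite oddM oddX.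
have p_ge3 : (2 < p)%N by clear -p_odd p_gt1; lia.
have m_ge6 : (6 <= m)%N.
  by rewrite -[6%N]/(2 * 3)%N leq_mul // expnS leq_pmulr // expn_gt0.
have [||y [pery y_neq0 visits]] := two_negative_orbit hg gK rK z_gt0 gz deep (n := m - 5).
- apply: (lt_trans lt_z); have := preimage_side hg rK z_gt0 gz (m - 5 + 2).
  by have -> : odd (m - 5 + 2) by clear -m_even m_ge6; lia.
- exact: ltW.
have m5 : (m - 5 + 5 = m)%N by clear -m_ge6; lia.
rewrite m5 in pery visits.
by exists y; rewrite visits (negbTE m_even) andbF.
Qed.

(** In the shallow case the induction hypothesis is used with [e = true]: the
    renormalized orbit has an even number of positive points, and these are the
    negative points of the original orbit. *)
Lemma fold_map_forcing (R : realType) (g : R -> R) (x : R) (a b p q : nat) (e : bool) :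
    decreasing_homeo g ->
    odd p -> (1 < p)%N -> odd q -> (1 < q)%N ->
    (b < a)%N || (a == b) && (q < p)%N ->
    has_prime_period (fold_map g) (2 ^ b * q) x ->
  has_signed_orbit (fold_map g) (2 ^ a * p) e.
Proof.
move=> + p_odd p_gt1 q_odd q_gt1.
elim: b a g x e => [|b IHb] a g x e hg lt_ba perx.
all: set N := (2 ^ _ * q)%N in perx.
all: have N_gt1 : (1 < N)%N by rewrite (leq_trans q_gt1) // leq_pmull // expn_gt0.
all: have [z z_gt0 gz] := positive_fixed_point hg (peak_gt0 hg perx N_gt1).
all: have [deep|shallow] := ltP (g (g 0)) (- z);
  first exact: (deep_forcing _ hg z_gt0 gz deep p_odd p_gt1 q_odd q_gt1 lt_ba perx).
  have := shallow_period_even hg z_gt0 gz shallow perx N_gt1.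
  by rewrite /N expn0 mul1n q_odd.
case: a lt_ba => [|a lt_ba]; first by case/orP => // /andP[].
have doubleE c d : (2 ^ c.+1 * d = (2 ^ c * d).*2)%N by rewrite expnS -mulnA mul2n.
rewrite /N doubleE in perx.
have [y pery] := renormalized_orbit hg z_gt0 gz shallow perx.
have hG := renormalization_homeo hg.
have [u [peru u_neq0 visits]] := IHb a _ y true hG lt_ba pery.
have k_gt1 : (1 < 2 ^ a * p)%N by rewrite (leq_trans p_gt1) // leq_pmull // expn_gt0.
have [peru' u'_neq0 sum_visits] := unrenormalized_orbit hg z_gt0 gz peru k_gt1 u_neq0.
rewrite doubleE; exists (- u); split=> //.
rewrite odd_double andbF.
have := congr1 odd sum_visits; rewrite oddD visits /=.
by case: (odd _) (odd _) => [] [].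
Qed.

(** * The decreasing Lorenz map over a fold map *)
Definition unfold_map (R : realType) (g : R -> R) (x : R) : R :=
  if x <= 0 then - g (- x) else g x.

Section UnfoldMap.
Context (R : realType) (g : R -> R) (hg : decreasing_homeo g).
Implicit Types (x y : R) (n k i : nat).
Local Notation f := (fold_map g).
Local Notation psi := (unfold_map g).

Lemma unfold_mapE x : x != 0 -> psi x = (-1) ^+ (x < 0)%R * f x.
Proof.
rewrite /unfold_map; case: ltgtP => // [x_lt0|x_gt0] _.
  by rewrite fold_map_nonpos ?(ltW x_lt0) // mulN1r.
by rewrite fold_map_nonneg ?(ltW x_gt0) // mul1r.
Qed.

Lemma unfold_mapN x : x != 0 -> psi (- x) = - psi x.
Proof.
rewrite /unfold_map oppr_le0; case: ltgtP => // _ _; by rewrite !opprK.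
Qed.

Lemma norm_iter_unfold k x : `|iter k psi x| = `|iter k f x|.
Proof.
elim: k => [//|k IHk]; rewrite !iterS.
have -> : f (iter k f x) = g `|iter k psi x| by rewrite IHk.
by rewrite /unfold_map; case: ler0P => // _; rewrite normrN.
Qed.

(** [psi] agrees with [f] on the positive side, with [- f] on the negative side,
    and is odd away from the turning point; so each negative point of the orbit of
    [f] contributes one change of sign. *)
Lemma iter_unfold_sign m x : (forall i, iter i f x != 0) ->
  iter m psi x = (-1) ^+ negative_visits f m x * iter m f x.
Proof.
move=> x_neq0; elim: m => [|m IHm].
  by rewrite /negative_visits big_geq // mul1r.
rewrite !iterS IHm /negative_visits big_nat_recr //= exprD -mulrA.
rewrite -unfold_mapE // -signr_odd; case: (odd _).
  by rewrite !mulN1r unfold_mapN.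
by rewrite !mul1r.
Qed.

Lemma unfold_prime_period m x : has_prime_period f m x ->
  (forall i, iter i f x != 0) -> ~~ odd (negative_visits f m x) ->
  has_prime_period psi m x.
Proof.
move=> perx x_neq0 visits; have [m_gt0 fx _] := perx; split=> // [|k].
  by rewrite iter_unfold_sign // fx -signr_odd (negbTE visits) mul1r.
case/andP=> k_gt0 lt_k psi_k.
have : iter k f (f x) = f x.
  by rewrite -iterSr iterS /fold_map -norm_iter_unfold psi_k.
move/(prime_period_dvdn (prime_period_iter 1 perx)).
by move/(dvdn_leq k_gt0); rewrite leqNgt lt_k.
Qed.

Lemma iter_unfoldN k x : (forall i, iter i psi x != 0) ->
  iter k psi (- x) = - iter k psi x.
Proof.
by move=> x_neq0; elim: k => [//|k IHk]; rewrite !iterS IHk unfold_mapN.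
Qed.

(** If [d] is the period of [f x] under [f], then [psi^d x] is [x] or [- x].  In the
    second case [psi^(2d) x = x] by oddness.  Oddness fails at the turning point,
    where [psi] jumps; an orbit through it is started there, which leaves only the
    first case. *)
Lemma fold_period_of_unfold n x : has_prime_period psi n x ->
  exists d y, has_prime_period f d y /\ (n = d \/ n = d.*2).
Proof.
wlog x_or : x / x = 0 \/ forall i, iter i psi x != 0.
  move=> hwlog perx.
  have [[i i0]|no0] := pselect (exists i, iter i psi x = 0).
    by apply: (hwlog 0); [left|rewrite -i0; exact: prime_period_iter].
  apply: (hwlog x) => //; right=> i; apply/eqP => i0; apply: no0.
  by exists i.
move=> perx; have [n_gt0 psi_n _] := perx.
pose y := f x.
have fy k : (iter k f y == y) = (`|iter k psi x| == `|x|).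
  rewrite norm_iter_unfold -iterSr iterS /y /fold_map.
  by apply/eqP/eqP => [/(bij_inj (homeo_bijective hg))|->].
have ex_d : exists k, (0 < k)%N && (iter k f y == y).
  by exists n; rewrite n_gt0 fy psi_n eqxx.
case: (ex_minnP ex_d) => d /andP[d_gt0 fd] d_min.
exists d, y; split.
  split=> // [|k /andP[k_gt0 lt_k] fk]; first exact/eqP.
  by have := d_min k; rewrite k_gt0 fk eqxx leqNgt lt_k => /(_ isT).
have d_le : (d <= n)%N by apply: d_min; rewrite n_gt0 fy psi_n eqxx.
have [psi_d|psi_d] : iter d psi x = x \/ iter d psi x = - x.
  by move: fd; rewrite fy eqr_norm2 => /orP[] /eqP; [left|right].
- left; apply/eqP; rewrite eqn_leq d_le andbT.
  exact: dvdn_leq (prime_period_dvdn perx psi_d).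
have psi_2d : iter (d + d) psi x = x.
  rewrite iterD psi_d; case: x_or => [x0|x_neq0].
    by rewrite x0 oppr0 -[in LHS]x0 psi_d x0 oppr0.
  by rewrite iter_unfoldN // psi_d opprK.
have /dvdnP[t t_eq] := prime_period_dvdn perx psi_2d.
have [->|neq] := eqVneq n d; [by left|right].
rewrite -addnn t_eq; case: t t_eq => [|[|t]] t_eq; clear -t_eq d_gt0 d_le neq; nia.
Qed.

End UnfoldMap.

(** * Centring a symmetric unimodal map at its turning point *)
Definition clamp (R : realType) (t : R) : R := Num.max 0 (Num.min t 2^-1).

Section Transport.
Context (R : realType) (f : R -> R) (hf : symmetric_unimodal f).
Implicit Types (x y t : R).

(** The right half of the graph, centred at the turning point and extended by
    lines of slope [- 1] to a decreasing homeomorphism of the line. *)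
Definition half_profile t : R := f (2^-1 + clamp t) - 2^-1 - (t - clamp t).
Local Notation g := half_profile.

Lemma clampE t :
  clamp t = if t <= 0 then 0 else if t <= 2^-1 then t else 2^-1.
Proof.
rewrite /clamp; have [t_le|t_gt] := lerP t 0.
  by rewrite min_l ?max_l //; lra.
by have [t_le|t_gt'] := lerP t 2^-1; rewrite max_r //; lra.
Qed.

Lemma clamp_bounds t : 0 <= clamp t <= 2^-1.
Proof.
rewrite clampE; case: (lerP t 0) => ?; last case: (lerP t) => ?.
all: by apply/andP; split; lra.
Qed.

Lemma half_profile_mid t : 0 <= t <= 2^-1 -> g t = f (2^-1 + t) - 2^-1.
Proof.
case/andP=> t0 t1; have -> : g t = f (2^-1 + clamp t) - 2^-1 - (t - clamp t) by [].
have -> : clamp t = t by rewrite /clamp min_l // max_r.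
by rewrite subrr subr0.
Qed.

Lemma half_profile_homeo : decreasing_homeo g.
Proof.
have c_clamp : continuous (@clamp R).
  move=> t; apply: (@continuous_max R R (fun=> 0) (fun s => Num.min s 2^-1)).
    exact: cvg_cst.
  apply: (@continuous_min R R id (fun=> 2^-1)); first exact: cvg_id.
  exact: cvg_cst.
have clamp_in t : 2^-1 + clamp t \in `[0, 1].
  by have /andP[? ?] := clamp_bounds t; rewrite in_itv /=; apply/andP; split; lra.
have c_f : continuous (fun t => f (2^-1 + clamp t)).
  move=> t; have /subspace_continuousP cf := unimodal_continuous hf.
  have c_in : {for t, continuous (fun s => 2^-1 + clamp s)}.
    by apply: cvgD; [exact: cvg_cst|exact: c_clamp].
  apply: (@cvg_comp _ _ _ (fun s => 2^-1 + clamp s) f _ _ _ _ (cf _ (clamp_in t))).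
  move=> B /= wB; apply: (@filterS _ (nbhs t) _ _ _ _ (c_in _ wB)) => s wBs.
  exact: wBs (clamp_in s).
have c_g : continuous g.
  move=> t; apply: cvgB; last by apply: cvgB; [exact: cvg_id|exact: c_clamp].
  by apply: cvgB; [exact: c_f|exact: cvg_cst].
have g_dec s t : s < t -> g t < g s.
  move=> lt_st.
  have [le_c le_diff] : clamp s <= clamp t /\ clamp t - clamp s <= t - s.
    rewrite !clampE; case: (lerP s 0) => ?; case: (lerP s 2^-1) => ?;
    by case: (lerP t 0) => ?; case: (lerP t 2^-1) => ?; split; lra.
  have [eq_c|neq_c] := eqVneq (clamp s) (clamp t).
    by rewrite /half_profile eq_c; lra.
  have lt_c : clamp s < clamp t by rewrite lt_neqAle neq_c.
  have /andP[? ?] := clamp_bounds s; have /andP[? ?] := clamp_bounds t.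
  have : f (2^-1 + clamp t) < f (2^-1 + clamp s).
    by apply: (unimodal_decreasing hf); rewrite ?in_itv /= ?ltrD2l //; apply/andP; split; lra.
  by rewrite /half_profile; lra.
have g_inj : injective g.
  move=> s t eq_g; have [/g_dec|/g_dec|//] := ltgtP s t; by rewrite eq_g ltxx.
have g_surj y : exists t, g t = y.
  have := normr_ge0 y; have := ler_norm y; have := ler_norm (- y); rewrite normrN => ? ? ?.
  have f1 : 0 <= f 1 <= 1.
    by have := @unimodal_maps _ _ hf 1; rewrite !in_itv /= ler01 lexx; apply.
  have [|||t eq_t _] :=
    @fixed_point_between R (fun t => t + (g t - y)) (- `|y| - 1) (`|y| + 2).
  - move=> t; apply: cvgD; first exact: cvg_id.
    by apply: cvgB; [exact: c_g|exact: cvg_cst].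
  - have -> : g (- `|y| - 1) = 2^-1 + `|y| + 1.
      rewrite /half_profile.
      have -> : clamp (- `|y| - 1) = 0 by rewrite /clamp min_l ?max_l //; lra.
      by rewrite addr0 (unimodal_top hf); lra.
    by lra.
  - have -> : g (`|y| + 2) = f 1 - `|y| - 2.
      rewrite /half_profile.
      have -> : clamp (`|y| + 2) = 2^-1 by rewrite /clamp min_r ?max_r //; lra.
      have -> : 2^-1 + 2^-1 = 1 :> R by lra.
      lra.
    by case/andP: f1 => ? ?; lra.
  by exists t; lra.
have [r rK] := choice g_surj.
by split=> //; exists r => // t; apply: g_inj; rewrite rK.
Qed.

Lemma decreasing_lorenz_in x :
  x \in `[0, 1] -> decreasing_lorenz f x \in `[0, 1].
Proof.
move=> /(unimodal_maps hf); rewrite /decreasing_lorenz /increasing_lorenz.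
by rewrite !in_itv /=; case: ifP => _ /andP[? ?]; apply/andP; split; lra.
Qed.

Lemma decreasing_lorenz_centred x : x \in `[0, 1] ->
  decreasing_lorenz f x - 2^-1 = unfold_map g (x - 2^-1).
Proof.
move=> x_in; move: (x_in); rewrite in_itv /= => /andP[x0 x1].
rewrite /decreasing_lorenz /increasing_lorenz /unfold_map subr_le0.
case: lerP => [le_x|lt_x].
  rewrite half_profile_mid; last by apply/andP; split; lra.
  have -> : 2^-1 + - (x - 2^-1) = 1 - x by lra.
  by rewrite (unimodal_symmetric hf) //; lra.
rewrite half_profile_mid; last by apply/andP; split; lra.
have -> : 2^-1 + (x - 2^-1) = x by lra.
lra.
Qed.

Lemma iter_decreasing_lorenz k x : x \in `[0, 1] ->
  iter k (decreasing_lorenz f) x - 2^-1 = iter k (unfold_map g) (x - 2^-1).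
Proof.
move=> x_in; have orbit_in i : iter i (decreasing_lorenz f) x \in `[0, 1].
  by elim: i => [//|i IHi]; exact: decreasing_lorenz_in.
by elim: k => [//|k IHk]; rewrite !iterS decreasing_lorenz_centred // IHk.
Qed.

Lemma decreasing_lorenz_prime_period n x : x \in `[0, 1] ->
  has_prime_period (decreasing_lorenz f) n x <->
  has_prime_period (unfold_map g) n (x - 2^-1).
Proof.
move=> x_in; split=> -[n_gt0 per prime]; split=> //.
- by rewrite -iter_decreasing_lorenz // per.
- move=> k /prime neq; rewrite -iter_decreasing_lorenz //.
  by move/(addIr _)/neq.
- by apply: (@addIr _ (- 2^-1)); rewrite iter_decreasing_lorenz.
- by move=> k /prime neq eq_k; apply: neq; rewrite -iter_decreasing_lorenz // eq_k.
Qed.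

End Transport.

(** * Forcing of periods for the decreasing Lorenz map *)

(** Folding may halve the given period; since this only lowers its power of two,
    the target still follows in the order.  The bounds on the new orbit keep it in
    the interval on which [half_profile] comes from the original map. *)
Lemma unfold_map_forcing (R : realType) (g : R -> R) (x : R) (a b p q : nat) :
    decreasing_homeo g -> odd p -> (1 < p)%N -> odd q -> (1 < q)%N ->
    (b < a)%N || (a == b) && (q < p)%N ->
    has_prime_period (unfold_map g) (2 ^ b * q) x ->
  exists2 y, has_prime_period (unfold_map g) (2 ^ a * p) y
           & g (g 0) <= y <= g 0.
Proof.
move=> hg p_odd p_gt1 q_odd q_gt1 lt_ba /(fold_period_of_unfold hg)[d [u [peru d_or]]].
have m_gt1 : (1 < 2 ^ a * p)%N by rewrite (leq_trans p_gt1) // leq_pmull // expn_gt0.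
have [y [pery y_neq0 visits]] : has_signed_orbit (fold_map g) (2 ^ a * p) false.
  case: d_or => d_eq; first by rewrite -d_eq in peru; exact: fold_map_forcing peru.
  case: b lt_ba d_eq => [|b] lt_ba d_eq.
    by move: q_odd; rewrite -[q]mul1n -(expn0 2) d_eq odd_double.
  have {}d_eq : (2 ^ b * q = d)%N.
    by apply: double_inj; rewrite -d_eq expnS -mulnA mul2n.
  rewrite -d_eq in peru; apply: fold_map_forcing peru => //.
  by apply/orP; left; case/orP: lt_ba => [/ltnW //|/andP[/eqP -> _]].
exists y; last exact: (orbit_bounds hg 0 pery m_gt1).
exact: (unfold_prime_period pery y_neq0 (negbT visits)).
Qed.

(** Among the powers of two the hypotheses leave only [m = 1], for which the fixed
    point of [g] serves; every other case has odd parts greater than one on both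
    sides. *)
Theorem theorem2 (R : realType) (f : R -> R) (n : nat)
    (hf : symmetric_unimodal f)
    (hn : exists2 x : R, x \in `[0, 1] &
            has_prime_period (decreasing_lorenz f) n x)
    (m : nat) (m_gt0 : (0 < m)%N) (hmn : sharkovsky m n)
    (hm : ~ exists2 r : nat, (1 <= r)%N & m = (2 ^ r)%N) :
  exists2 x : R, x \in `[0, 1] &
    has_prime_period (decreasing_lorenz f) m x.
Proof.
have hg := half_profile_homeo hf; set g := half_profile f in hg.
have g0 : g 0 = 2^-1.
  rewrite /g half_profile_mid; last by apply/andP; split; lra.
  by rewrite addr0 (unimodal_top hf); lra.
have gg0 : - 2^-1 <= g (g 0).
  rewrite g0 /g half_profile_mid; last by apply/andP; split; lra.
  have -> : 2^-1 + 2^-1 = 1 :> R by lra.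
  have := @unimodal_maps _ _ hf 1; rewrite !in_itv /= ler01 lexx => /(_ isT).
  by case/andP=> ? ?; lra.
have to_lorenz k y : g (g 0) <= y <= g 0 ->
    has_prime_period (unfold_map g) k y ->
    exists2 x : R, x \in `[0, 1] & has_prime_period (decreasing_lorenz f) k x.
  case/andP=> ge_y le_y pery; have x_in : y + 2^-1 \in `[0, 1].
    by rewrite in_itv /=; apply/andP; split; lra.
  exists (y + 2^-1) => //.
  by apply/(decreasing_lorenz_prime_period hf _ x_in); rewrite addrK.
have period1 : exists2 x : R, x \in `[0, 1] & has_prime_period (decreasing_lorenz f) 1 x.
  have [|z z_gt0 gz] := positive_fixed_point hg; first by rewrite g0; lra.
  have lt_z : z < g 0 by rewrite -[ltLHS]gz (homeo_lt hg).
  apply: (to_lorenz _ z).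
    by rewrite (ltW lt_z) andbT -[leRHS]gz (homeo_le hg) ltW.
  split=> // [|k /andP[k_ge1 k_lt1]]; last by rewrite ltnNge k_ge1 in k_lt1.
  by rewrite /= /unfold_map leNgt z_gt0.
have [x x_in /(decreasing_lorenz_prime_period hf _ x_in) perx] := hn.
have no_pow2 a : m = (2 ^ a)%N -> m = 1%N.
  by case: a => [//|a] m_eq; case: hm; exists a.+1.
have block a b p q : odd p -> (1 < p)%N -> odd q -> (1 < q)%N ->
    (b < a)%N || (a == b) && (q < p)%N ->
    m = (2 ^ a * p)%N -> n = (2 ^ b * q)%N ->
    exists2 x : R, x \in `[0, 1] & has_prime_period (decreasing_lorenz f) m x.
  move=> p_odd p_gt1 q_odd q_gt1 lt_ba m_eq n_eq; rewrite n_eq in perx.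
  have [y pery y_in] := unfold_map_forcing hg p_odd p_gt1 q_odd q_gt1 lt_ba perx.
  by rewrite m_eq; exact: to_lorenz y_in pery.
clear perx hn hm m_gt0; case: m n / hmn block no_pow2.
- by move=> a b _ _ /(_ a erefl) ->.
- by move=> a b q _ _ _ /(_ a erefl) ->.
- move=> a b p q p_odd p_gt1 q_odd q_gt1 lt_ba block _.
  by apply: (block a b p q); rewrite ?lt_ba.
- move=> a p q p_odd q_odd q_gt1 lt_qp block _.
  by apply: (block a a p q); rewrite ?eqxx ?lt_qp ?orbT // (ltn_trans q_gt1).
Qed.
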